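(* There is no $(5,2;+1)$-digraph; that is, there is no $2$-geodetic digraph with minimum out-degree $5$ and order $1+5+5^2+1=32$.
   Context: Digraphs are finite and without multiple arcs. A digraph $G$ is $k$-geodetic if for any (not necessarily distinct) vertices $u,v$ there is at most one directed walk from $u$ to $v$ of length at most $k$ (walks of length $0$ count, so there are no directed cycles of length at most $k$). A $(d,k;+1)$-digraph is a $k$-geodetic digraph with minimum out-degree $d$ and order $M(d,k)+1$, where $M(d,k)=1+d+d^2+\dots+d^k$. It is known that every $(d,k;+1)$-digraph with $d,k\ge 2$ is diregular (all in-degrees and out-degrees equal $d$). *)

(* Defs.v *)
From mathcomp Require Import all_boot.

Set Implicit Arguments.
Unset Strict Implicit.
Unset Printing Implicit Defensive.

(* A digraph is a relation [e] on a finite type [T] of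
   vertices: [e u v] means that there is an arc from [u] to [v].  There are no
   multiple arcs; loops are not excluded a priori. *)

Section Digraph.

Variables (T : finType) (e : rel T).

(* The walk u = x_0 -> x_1 -> ... -> x_n = v is encoded by its starting vertex
   u and the sequence [:: x_1; ...; x_n], whose size is its length n. *)
Definition walk (u v : T) (p : seq T) : bool := path e u p && (last u p == v).

Definition k_geodetic (k : nat) : Prop :=
  forall (u v : T) (p q : seq T),
    walk u v p -> size p <= k -> walk u v q -> size q <= k -> p = q.

Definition out_degree (u : T) : nat := #|[set v | e u v]|.

Definition min_out_degree (d : nat) : Prop :=
  (forall u : T, d <= out_degree u) /\ (exists u : T, out_degree u = d).

Definition moore_bound (d k : nat) : nat := \sum_(i < k.+1) d ^ i.

(* Usually written "(d,k;+1)-digraph": the order exceeds the Moore bound by 1. *)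
Definition excess_one_digraph (d k : nat) : Prop :=
  [/\ k_geodetic k, min_out_degree d & #|T| = moore_bound d k + 1].

End Digraph.

(* Main.v *)
Require Import Defs.
From mathcomp Require Import all_boot all_order all_algebra all_fingroup all_solvable all_field.
From mathcomp Require Import ring zify.
From Stdlib Require Import BinNat Nnat.
Delimit Scope nat_scope with N.
Delimit Scope N_scope with num.

Set Implicit Arguments.
Unset Strict Implicit.
Unset Printing Implicit Defensive.

Import Order.TTheory GRing.Theory Num.Theory.

(* Let v = d^2 + d + 2.  A (d,2;+1)-digraph is out-regular, each vertex u misses
   exactly one vertex o(u) by walks of length at most 2, and the adjacency matrix
   satisfies A^2 + A + 1 = J - P, where P is the matrix of o.  If some in-degree
   exceeds d, then all outliers have the same out-neighbourhood, so (J - P)A has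
   constant columns and A(A^2 + A + 1) is a multiple of an idempotent of rank 1;
   the other eigenvalues of A are 0 and the two primitive cube roots of unity, and
   tr A = tr A^2 = 0 is then impossible.  Otherwise in-degrees are d, and P is a
   permutation matrix commuting with A.

   In that case put B = 2A + 1, so that B^2 = 4J - 4P - 3, and split the space into
   the eigenspaces of P.  On the eigenspace of a root of unity z <> 1, B squares to
   -3 - 4z.  If z has order 3 or 5, ..., 32, then -3 - 4z is not a square in Q(z), so
   B has trace 0 there.  Let m and t be the traces of 1 and of A on the eigenspace of
   z = 1; as -7 < 0 is not a square in R, 2t + m = 2d + 1.  Since tr(P^j) >= 0 and
   tr(A P^j) >= 0, the traces of 1 and of A on any other eigenspace are at most m and t
   in modulus.  For z = -1 the eigenvalues of B are 1 and -1, which contributes at most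
   m to tr B; for z = i or -i they are 1 - 2z and 2z - 1, which contributes a real part
   of at most t each.  Hence v = tr B <= (2d + 1) + m + 2t = 2(2d + 1), so d <= 3. *)

(** * Walks of length at most 2: out-degrees, outliers and in-degrees *)

Section Counting.

Variables (T : finType) (e : rel T) (d : nat).
Hypothesis e_excess : excess_one_digraph e d 2.

Lemma card_excess_one : #|T| = d * d + d + 2.
Proof.
case: e_excess => _ _ ->; rewrite /moore_bound !big_ord_recl big_ord0 /=.
by rewrite /bump /= expn0 expn1 expnS expn1; lia.
Qed.

Hypothesis d_gt0 : 0 < d.

Let geo : k_geodetic e 2. Proof. by case: e_excess. Qed.

(** The entry at (u, v) of 1 + A + A^2, where A is the adjacency matrix. *)
Definition walks2 u v : nat := (u == v) + (e u v + \sum_w e u w * e w v).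

Lemma walks2_le1 u v : walks2 u v <= 1.
Proof.
have two_steps w : e u w -> e w v -> walk e u v [:: w; v].
  by move=> uw wv; rewrite /walk /= uw wv eqxx.
have -> : walks2 u v = (u == v) + (e u v + #|[pred w | e u w && e w v]|).
  congr (_ + (_ + _)); rewrite -sum1_card [RHS]big_mkcond /=.
  by apply: eq_bigr => w _; rewrite inE mulnb; case: (_ && _).
have le1 : #|[pred w | e u w && e w v]| <= 1.
  apply/card_le1_eqP => w w'; rewrite !inE => /andP[uw wv] /andP[uw' w'v].
  by have [] := geo (two_steps w uw wv) isT (two_steps w' uw' w'v) isT.
have pred0 p : size p <= 1 -> walk e u v p -> #|[pred w | e u w && e w v]| = 0.
  move=> szp wp; apply: eq_card0 => w; rewrite !inE; apply/negP=> /andP[uw wv].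
  have := geo wp (leqW szp) (two_steps w uw wv) isT.
  by move=> p_eq; rewrite p_eq in szp.
have [uv|_] := boolP (u == v).
  have wp : walk e u v [::] by [].
  rewrite (pred0 [::]) //; case: (boolP (e u v)) => // euv.
  by have := geo wp isT (_ : walk e u v [:: v]) isT; rewrite /walk /= euv eqxx => /(_ isT).
case: (boolP (e u v)) => // euv.
by rewrite (pred0 [:: v]) // /walk /= euv eqxx.
Qed.

Lemma out_degreeE u : out_degree e u = \sum_v e u v.
Proof.
rewrite /out_degree -sum1_card big_mkcond; apply: eq_bigr => v _.
by rewrite inE; case: (e u v).
Qed.

Lemma sum_walks2_row u :
  \sum_v walks2 u v = 1 + (out_degree e u + \sum_w e u w * out_degree e w).
Proof.
rewrite !big_split /= (bigD1 u) //= eqxx big1 => [|v /negPf]; last first.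
  by rewrite eq_sym => ->.
rewrite addn0 -out_degreeE exchange_big /=; congr (_ + (_ + _)).
by apply: eq_bigr => w _; rewrite -big_distrr -out_degreeE.
Qed.

(** An out-degree above [d] would give at least 1 + (d + 1) + (d + 1)d walks of length at most 2
    from [u]. Their ends are distinct, and there are only d^2 + d + 2 vertices. *)
Lemma out_regular u : \sum_v e u v = d.
Proof.
have [_ [out_ge _] _] := e_excess.
apply/eqP; rewrite -out_degreeE eqn_leq out_ge andbT leqNgt; apply/negP => out_gt.
have : \sum_v walks2 u v <= #|T|.
  by rewrite -sum1_card leq_sum // => v _; apply: walks2_le1.
rewrite sum_walks2_row card_excess_one.
have : (out_degree e u) * d <= \sum_w e u w * out_degree e w.
  by rewrite out_degreeE big_distrl leq_sum // => w _; rewrite leq_mul2l out_ge orbT.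
have : d.+1 * d <= out_degree e u * d by rewrite leq_mul2r out_gt orbT.
rewrite mulSn; lia.
Qed.

(** The 1 + d + d^2 walks from [u] have distinct ends, which leaves out exactly one vertex. *)
Lemma exists_outlier u : exists o, forall v, walks2 u v + (o == v) = 1.
Proof.
have row : \sum_v walks2 u v + 1 = #|T|.
  rewrite sum_walks2_row out_degreeE out_regular card_excess_one.
  rewrite (eq_bigr (fun w => e u w * d)) => [|w _]; last by rewrite out_degreeE out_regular.
  by rewrite -big_distrl /= out_regular; lia.
have missing : \sum_v (1 - walks2 u v) = 1.
  apply: (@addnI (\sum_v walks2 u v)); rewrite -big_split row -sum1_card.
  by apply: eq_bigr => v _; rewrite /= subnKC ?walks2_le1.
have [o o_miss] : exists o, 1 - walks2 u o != 0.
  apply/existsP; apply: contraPT missing => /existsPn no_o.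
  by rewrite big1 // => v _; apply/eqP; move: (no_o v); rewrite negbK.
exists o => v; have := walks2_le1 u v; have := walks2_le1 u o.
have [<-|ov] := eqVneq o v; first by lia.
move: missing; rewrite (bigD1 o) // (bigD1 v) 1?eq_sym //=; lia.
Qed.

Section Outlier.

Variable o : T -> T.
Hypothesis oP : forall u v, walks2 u v + (o u == v) = 1.

Definition in_deg v : nat := \sum_u e u v.

Lemma loopless v : e v v = false.
Proof. by have := walks2_le1 v v; rewrite /walks2 eqxx; case: (e v v). Qed.

Lemma sum_pick (f : T -> nat) u : \sum_x (u == x) * f x = f u.
Proof.
rewrite (bigD1 u) //= eqxx mul1n big1 ?addn0 // => x /negPf.
by rewrite eq_sym => ->.
Qed.

(** An entry of (1 + A + A^2)A + PA = JA. *)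
Lemma walks2_step u v : \sum_x walks2 u x * e x v + e (o u) v = in_deg v.
Proof.
rewrite -(sum_pick (fun x => e x v)) -big_split; apply: eq_bigr => x _.
by rewrite /= -mulnDl oP mul1n.
Qed.

(** Since 1 + A + A^2 = J - P commutes with A, PA + AJ = JA + AP; this is the entry at (u, v), with
    AJ = dJ. *)
Lemma outlier_commute u v :
  e (o u) v + d = in_deg v + \sum_w e u w * (o w == v).
Proof.
have walks3 : \sum_w e u w * walks2 w v = \sum_x walks2 u x * e x v.
  under eq_bigr do rewrite !mulnDr.
  under [in RHS]eq_bigr do rewrite !mulnDl.
  rewrite !big_split /= sum_pick; congr (_ + (_ + _)).
    by rewrite -[RHS](sum_pick (fun x => e u x)); apply: eq_bigr => w _; rewrite mulnC eq_sym.
  under eq_bigr do rewrite big_distrr.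
  under [in RHS]eq_bigr do rewrite big_distrl.
  rewrite exchange_big /=; apply: eq_bigr => x _; apply: eq_bigr => w _.
  by rewrite mulnA.
rewrite -(walks2_step u v).
have -> : d = \sum_w e u w * walks2 w v + \sum_w e u w * (o w == v).
  rewrite -(out_regular u) -big_split; apply: eq_bigr => w _.
  by rewrite /= -mulnDr oP muln1.
by rewrite walks3; lia.
Qed.

Lemma in_deg_sum v :
  1 + in_deg v + \sum_u e u v * in_deg u + \sum_u (o u == v) = d * d + d + 2.
Proof.
rewrite -card_excess_one -sum1_card.
rewrite [RHS](eq_bigr (fun u => walks2 u v + (o u == v))) => [|u _]; last by rewrite oP.
rewrite !big_split /= -!addnA; congr (_ + (_ + (_ + _))).
  rewrite (eq_bigr (fun u => (v == u) * 1)) ?(sum_pick (fun=> 1)) // => u _.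
  by rewrite muln1 eq_sym.
rewrite exchange_big; apply: eq_bigr => w _.
by rewrite /= mulnC big_distrl.
Qed.

Lemma sum_in_deg : \sum_v in_deg v = #|T| * d.
Proof.
rewrite exchange_big (eq_bigr (fun=> d)) => [|u _]; last exact: out_regular.
by rewrite sum_nat_const.
Qed.

Lemma in_deg_le v : in_deg v <= d.+1.
Proof. by have := outlier_commute v v; case: (e _ v) => /=; lia. Qed.

Lemma outlier_to_excess u v : in_deg v = d.+1 -> e (o u) v.
Proof. by move=> in_v; have := outlier_commute u v; rewrite in_v; case: (e _ v) => //=; lia. Qed.

(** By [outlier_commute] at (x, x), [x] is the outlier of one of its out-neighbours, so
    [outlier_to_excess] applies to it. *)
Lemma deficient_to_excess x v : in_deg v = d.+1 -> in_deg x < d -> e x v.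
Proof.
move=> in_v in_x; have := outlier_commute x x.
have [/eqP ->|] := boolP (\sum_w e x w * (o w == x) == 0); first by lia.
rewrite sum_nat_eq0 negb_forall => /existsP[w]; rewrite /= muln_eq0 negb_or.
by case: (o w =P x) => [<- _ _|_]; [apply: outlier_to_excess | rewrite andbF].
Qed.

(** Vertices of in-degree d + 1 are out-neighbours of every outlier, which has only [d] of them, so
    it suffices to find [d] such vertices. As there are no loops, [v] is not an outlier, so its d +
    1 in-neighbours have total in-degree d^2. The in-degrees of the other vertices then sum to [d]
    more than [d] times their number, and each is d or d + 1, because smaller ones occur only at
    in-neighbours of [v]. *)
Lemma outlier_row v : in_deg v = d.+1 ->
  forall u x, e (o u) x = (in_deg x == d.+1).
Proof.
move=> in_v u.
have no_outlier : \sum_u (o u == v) = 0.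
  apply: big1 => x _; case: eqP => // ox.
  by have := outlier_to_excess x in_v; rewrite ox loopless.
have into : \sum_x e x v * in_deg x = d * d.
  by have := in_deg_sum v; rewrite in_v no_outlier; lia.
have outside : \sum_x ~~ e x v * in_deg x
    = \sum_x ~~ e x v * d + \sum_x ~~ e x v * (in_deg x == d.+1).
  rewrite -big_split; apply: eq_bigr => x _.
  case: (boolP (e x v)) => //= xv; rewrite !mul1n.
  have := in_deg_le x; case: (ltnP (in_deg x) d) => [x_def|]; last by case: eqP; lia.
  by have := deficient_to_excess in_v x_def; rewrite (negPf xv).
have splits (f : T -> nat) : \sum_x f x = \sum_x e x v * f x + \sum_x ~~ e x v * f x.
  by rewrite -big_split; apply: eq_bigr => x _; case: (e x v); rewrite /= ?mul1n ?addn0.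
have excess_outside : \sum_x ~~ e x v * (in_deg x == d.+1) = d.
  have := splits in_deg; have := splits (fun=> d).
  have -> : \sum_(x : T) d = #|T| * d by rewrite sum_nat_const.
  by rewrite sum_in_deg outside into -big_distrl /= -/(in_deg v) in_v; lia.
have le_row x : (in_deg x == d.+1) <= e (o u) x.
  by case: eqP => // /outlier_to_excess ->.
have : \sum_x (e (o u) x - (in_deg x == d.+1)) = 0.
  apply/eqP; rewrite -leqn0 -(leq_add2l (\sum_x (in_deg x == d.+1))) -big_split addn0.
  rewrite (eq_bigr (fun x => nat_of_bool (e (o u) x))) => [|x _]; last by rewrite /= subnKC.
  rewrite out_regular -{1}excess_outside leq_sum // => x _.
  by case: (e x v); case: (_ == _).
move/eqP; rewrite sum_nat_eq0 => /forallP eq_row x.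
by have := eq_row x; have := le_row x; case: (e _ x); case: (_ == _).
Qed.

(** In-degrees average [d], so all equal [d] unless one exceeds it. *)
Lemma in_regular_or_constant_outlier_row :
  (forall v, in_deg v = d) \/
  exists S : pred T, forall u x, e (o u) x = S x.
Proof.
have [/forallP in_le|] := boolP [forall v, in_deg v <= d]; last first.
  rewrite negb_forall => /existsP[v]; rewrite -ltnNge => v_gt; right.
  exists (fun x => in_deg x == d.+1); apply: (@outlier_row v).
  by apply/eqP; rewrite eqn_leq in_deg_le.
left => v; apply/eqP; rewrite eqn_leq in_le /= leqNgt; apply/negP=> v_lt.
have : \sum_x in_deg x < \sum_(x : T) d.
  by rewrite (bigD1 v) // [X in _ < X](bigD1 v) //= -addSn leq_add // leq_sum.
by rewrite sum_in_deg sum_nat_const ltnn.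
Qed.

(** With all in-degrees [d], the count in [in_deg_sum] leaves exactly 1 for each fibre of [o]. *)
Lemma outlier_inj : (forall v, in_deg v = d) -> injective o.
Proof.
move=> in_reg; have fiber v : \sum_u (o u == v) = 1.
  have := in_deg_sum v; rewrite in_reg (eq_bigr (fun u => e u v * d)) => [|u _].
    by rewrite -big_distrl /= -/(in_deg v) in_reg; lia.
  by rewrite in_reg.
move=> x y oxy; apply/eqP; apply: contraT => xy.
have := fiber (o y); rewrite (bigD1 x) // (bigD1 y) 1?eq_sym //= oxy eqxx; lia.
Qed.

End Outlier.

End Counting.

Local Open Scope ring_scope.

(** * Cyclotomic polynomials over arbitrary integral domains *)

Lemma root_Cyclotomic (R : idomainType) n (w : R) :
  n.-primitive_root w -> root (map_poly intr 'Phi_n) w.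
Proof.
move=> prim_w; have n_gt0 := prim_order_gt0 prim_w.
have mapX1 d : map_poly intr ('X^d - 1 : {poly int}) = 'X^d - 1 :> {poly R}.
  by rewrite rmorphB rmorph1 /= map_polyXn.
have : root (map_poly intr ('X^n - 1 : {poly int})) w.
  by rewrite mapX1 rootE !hornerE prim_expr_order // subrr.
(* Some ['Phi_d] with d dividing n vanishes at [w]; then w^d = 1, which forces d = n. *)
rewrite -prod_Cyclotomic // rmorph_prod /= rootE horner_prod prodf_seq_eq0.
case/hasP=> d; rewrite -dvdn_divisors //= => d_dv_n rw.
have d_gt0 : (0 < d)%N by apply: dvdn_gt0 d_dv_n.
have : root (map_poly intr ('X^d - 1 : {poly int})) w.
  rewrite -prod_Cyclotomic // (big_rem d) -?dvdn_divisors //=.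
  by rewrite rmorphM rootM [root _ w]rw.
rewrite mapX1 rootE !hornerE subr_eq0 -(prim_order_dvd prim_w) => n_dv_d.
by have /eqP <- : d == n by rewrite eqn_dvd d_dv_n.
Qed.

(** ['Phi_n] is the minimal polynomial of [z], so by Gauss's lemma it divides [G] over the integers.
    Relations at [z] can thus be reduced modulo a prime. *)
Lemma root_specialize (R : idomainType) n (z : algC) (w : R) (G : {poly int}) :
  n.-primitive_root z -> n.-primitive_root w ->
  root (map_poly intr G) z -> root (map_poly intr G) w.
Proof.
move=> prim_z prim_w Gz.
have QtoC (p : {poly int}) :
    map_poly intr p = map_poly ratr (map_poly intr p : {poly rat}) :> {poly algC}.
  by rewrite -map_poly_comp; apply: eq_map_poly => b; rewrite /= rmorph_int.
have [pf [Dpf _] dv_pf] := minCpolyP z.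
have Dphi : pf = map_poly intr 'Phi_n.
  apply: (map_inj_poly (fmorph_inj (ratr : rat -> algC))); first exact: rmorph0.
  by rewrite -QtoC (Cintr_Cyclotomic prim_z) -(minCpoly_cyclotomic prim_z).
move: Gz; rewrite QtoC dv_pf Dphi dvdp_rat_int => /dvdpP_int[r ->].
rewrite zprimitive_monic ?Cyclotomic_monic // rmorphM rootM.
by rewrite root_Cyclotomic.
Qed.

(** * Certificates modulo primes that -3 - 4z is not a square *)

Fixpoint powmod (q a : N) (k : nat) : N :=
  if k is k'.+1 then N.modulo (N.mul a (powmod q a k')) q else 1%num.

Lemma to_nat_mod a b : (0 < N.to_nat b)%N ->
  N.to_nat (N.modulo a b) = (N.to_nat a %% N.to_nat b)%N.
Proof.
move=> b_gt0; rewrite N2Nat.inj_mod; symmetry.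
apply: (PeanoNat.Nat.mod_unique _ _ (N.to_nat a %/ N.to_nat b)%N).
  by apply/ssrnat.ltP; rewrite ltn_pmod.
by rewrite multE plusE mulnC -divn_eq.
Qed.

Lemma to_nat_powmod q a k : (1 < N.to_nat q)%N ->
  N.to_nat (powmod q a k) = (N.to_nat a ^ k %% N.to_nat q)%N.
Proof.
move=> q_gt1; elim: k => [|k IHk] /=; first by rewrite expn0 modn_small.
by rewrite to_nat_mod ?(ltnW q_gt1) // N2Nat.inj_mul IHk multE modnMmr expnS.
Qed.

(** Euler's criterion: [d] represents -3 - 4z modulo [q], and its power of exponent (q - 1)/2 is -1.
    The congruence defining [d] is itself checked, which avoids reasoning about truncated
    subtraction. The bound [32 < p] puts [p] above the orders and ranks met later. *)
Definition nonsquare_check (n : nat) (q z : N) : bool :=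
  let p := N.to_nat q in
  let d := (q - (3 + 4 * z) mod q)%num in
  [&& prime p, 32 < p, powmod q z n == 1%num,
      all (fun k => powmod q z k != 1%num) (iota 1 n.-1),
      ((d + 3 + 4 * z) mod q == 0)%num & powmod q d p./2 == N.pred q]%N.

Lemma nonsquare_checkP n q z : (0 < n)%N -> nonsquare_check n q z ->
  exists p (w : 'F_p), [/\ prime p, (32 < p)%N, n.-primitive_root w &
    forall y : 'F_p, y ^+ 2 != - 3 - 4 * w].
Proof.
move=> n_gt0; rewrite /nonsquare_check.
set p := N.to_nat q; set d := N.sub _ _.
case/and5P=> p_pr p_gt32 zn zk /andP[d_def dp].
have p_gt1 := prime_gt1 p_pr.
have powF a k : (N.to_nat (powmod q a k))%:R = (N.to_nat a)%:R ^+ k :> 'F_p.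
  by rewrite to_nat_powmod // Fp_nat_mod // natrX.
exists p, (N.to_nat z)%:R; split => //.
  apply/andP; split=> //; apply/forallP=> i; rewrite unity_rootE.
  case: (eqVneq i.+1 n) => [->|i_n].
    by rewrite -powF (eqP zn) eqxx.
  rewrite eqbF_neg; apply/negP=> /eqP; rewrite -powF.
  move/(congr1 (@nat_of_ord _)); rewrite (val_Fp_nat p_pr) (val_Fp_nat p_pr 1).
  rewrite to_nat_powmod // modn_mod (modn_small p_gt1) => zi1.
  have /allP/(_ i.+1) := zk; rewrite mem_iota add1n prednK //.
  have -> : (i.+1 < n)%N by rewrite ltn_neqAle i_n ltn_ord.
  move=> /(_ isT)/eqP; apply.
  by apply: N2Nat.inj; rewrite to_nat_powmod.
move=> y; apply/eqP=> y2.
have Dd : (N.to_nat d)%:R = y ^+ 2 :> 'F_p.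
  have : (N.to_nat ((d + 3 + 4 * z) mod q)%num)%:R = 0 :> 'F_p by rewrite (eqP d_def).
  rewrite to_nat_mod ?prime_gt0 // (Fp_nat_mod p_pr) !N2Nat.inj_add N2Nat.inj_mul.
  rewrite !plusE multE 2!natrD natrM y2 => d0; apply/eqP.
  rewrite -subr_eq0; apply/eqP; rewrite -[RHS]d0.
  by rewrite -[N.to_nat 3]/3%N -[N.to_nat 4]/4%N; ring.
have odd_p : odd p by case/even_prime: p_pr p_gt32 => // ->.
have p2_gt0 : (0 < p./2)%N by rewrite half_gt0 (leq_trans _ p_gt32).
have := powF d p./2; rewrite (eqP dp) Dd -exprM mul2n N2Nat.inj_pred => N1.
(* If -3 - 4z were y^2, then y = y^p = y (y^2)^((p - 1)/2) = -y, so y = 0, but no positive power of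
   0 is -1. *)
have y_pow : y * y ^+ p./2.*2 = y.
  rewrite -exprS -[RHS]expf_card (card_Fp p_pr); congr (_ ^+ _).
  by rewrite -[RHS]odd_double_half odd_p.
have p1 : p.-1%:R = - 1 :> 'F_p.
  by apply/eqP; rewrite -subr_eq0 opprK natr1 prednK ?prime_gt0 // pchar_Fp_0.
rewrite -N1 p1 mulrN1 in y_pow.
have two_neq0 : 2%:R != 0 :> 'F_p.
  by rewrite -(dvdn_pcharf (pchar_Fp p_pr)) gtnNdvd // (leq_trans _ p_gt32).
have y0 : y = 0.
  apply/eqP; rewrite -[_ == 0]orFb -(negPf two_neq0) -mulf_eq0 mulr_natl mulr2n.
  by rewrite -{1}y_pow addNr.
move: N1; rewrite p1 y0 expr0n -(prednK p2_gt0) /= => /eqP.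
by rewrite oppr_eq0 oner_eq0.
Qed.

(* The entry of index n - 3 is a pair (q, z) with q > 32 prime, z of order n modulo q,
   and -3 - 4z a quadratic nonresidue modulo q.  For n = 4 there is only a dummy entry,
   as -3 - 4i = (1 - 2i)^2. *)
Definition nonsquare_witnesses : seq (N * N) :=
  [:: (37, 10); (0, 0); (41, 16); (43, 7); (43, 11); (41, 3);
   (37, 7); (41, 4); (67, 9); (37, 8); (53, 13); (43, 2);
   (61, 12); (97, 12); (103, 13); (37, 3); (191, 5); (41, 2);
   (43, 14); (67, 3); (47, 6); (73, 7); (101, 16); (53, 4);
   (109, 5); (113, 8); (59, 3); (61, 5); (311, 15); (97, 20)]%num.

Lemma nonsquare_witnessesP n : (2 < n <= 32)%N -> n != 4%N ->
  let qz := nth (0, 0)%num nonsquare_witnesses (n - 3) in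
  nonsquare_check n qz.1 qz.2.
Proof.
have /allP tableP : all (fun k => let qz := nth (0, 0)%num nonsquare_witnesses (k - 3) in
    nonsquare_check k qz.1 qz.2) [seq k <- iota 3 30 | k != 4%N] by vm_compute.
by move=> n_range n4; apply: tableP; rewrite mem_filter n4 mem_iota.
Qed.

(** In ['F_p] the equation would make -3 - 4w the square of F(w)/c unless [p] divides [c]. Keeping
    [p] explicit lets a bound on [c] force c = 0 later. *)
Lemma nonsquare_cyclotomic n (z : algC) (F : {poly int}) (c : int) :
  n.-primitive_root z -> (2 < n <= 32)%N -> n != 4%N ->
  (map_poly intr F).[z] ^+ 2 = c%:~R ^+ 2 * (- 3 - 4 * z) ->
  exists p, [/\ prime p, (32 < p)%N & (p %| `|c|)%N].
Proof.
move=> prim_z n_range n4 Fz.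
have n_gt0 : (0 < n)%N by rewrite (leq_trans _ (proj1 (andP n_range))).
have [p [w [p_pr p_gt32 prim_w w_nsq]]] :=
  nonsquare_checkP n_gt0 (nonsquare_witnessesP n_range n4).
exists p; split=> //; rewrite (dvdn_pcharf (pchar_Fp p_pr)).
pose G : {poly int} := F ^+ 2 - (c ^+ 2)%:P * (- 3%:P - 4%:P * 'X).
have G_horner (R : comNzRingType) (x : R) : (map_poly intr G).[x] =
    (map_poly intr F).[x] ^+ 2 - c%:~R ^+ 2 * (- 3 - 4 * x).
  rewrite /G !(rmorphB, rmorphM, rmorphXn, rmorphN) /= !map_polyC /= map_polyX.
  by rewrite !hornerE !expr2.
have := root_specialize (G := G) prim_z prim_w.
rewrite !rootE !G_horner Fz subrr eqxx subr_eq0 => /(_ isT)/eqP Fw.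
apply: contraT => c_neq0; have {}c_neq0 : c%:~R != 0 :> 'F_p.
  by move: c_neq0; case: (c) => m; rewrite // NegzE abszN mulrNz oppr_eq0.
have /eqP[] := w_nsq ((map_poly intr F).[w] / c%:~R).
by rewrite expr_div_n Fw mulrAC divff ?mul1r // expf_neq0.
Qed.

(** * Traces of idempotents and of square roots of their multiples *)

Lemma mxtrace_idem (F : fieldType) n (E : 'M[F]_n) :
  E *m E = E -> \tr E = (\rank E)%:R.
Proof.
(* For an idempotent, the rank factorisation E = CR satisfies RC = 1, an identity matrix whose size
   is the rank. *)
move=> EE; have RC1 : row_base E *m col_base E = 1%:M.
  apply: (row_full_inj (col_base_full E)); apply: (row_free_inj (row_base_free E)).
  have : (col_base E *m row_base E) *m (col_base E *m row_base E)
         = col_base E *m row_base E by rewrite mulmx_base.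
  by rewrite mulmx1 !mulmxA.
by rewrite -{1}(mulmx_base E) mxtrace_mulC RC1 mxtrace1.
Qed.

(** Z = Y/r is an involution on the image of [E], so (E + Z)/2 and (E - Z)/2 are idempotents. If a
    and b are their ranks, tr Z = a - b and tr E = a + b. *)
Lemma mxtrace_root_idem n (E Y : 'M[algC]_n.+1) (r : algC) :
  r != 0 -> E * E = E -> E * Y = Y -> Y * E = Y -> Y * Y = r ^+ 2 *: E ->
  exists2 c : int, \tr Y = c%:~R * r & `|c%:~R| <= \tr E.
Proof.
move=> r0 EE EY YE YY.
pose Z : 'M[algC]_n.+1 := r^-1 *: Y.
have [EZ ZE] : E * Z = Z /\ Z * E = Z by rewrite -scalerAr EY -scalerAl YE.
have ZZ : Z * Z = E.
  by rewrite -scalerAl -scalerAr YY !scalerA -expr2 -exprMn mulVf // expr1n scale1r.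
have idem (S : 'M[algC]_n.+1) : E * S = S -> S * E = S -> S * S = E ->
    (2^-1 *: (E + S)) *m (2^-1 *: (E + S)) = 2^-1 *: (E + S).
  move=> ES SE SS; rewrite mulmxE -scalerAl -scalerAr scalerA.
  rewrite mulrDl !mulrDr EE ES SE SS [S + E]addrC -mulr2n -scaler_nat scalerA.
  by congr (_ *: _); field.
have Dp := mxtrace_idem (idem Z EZ ZE ZZ).
have Dm := mxtrace_idem (idem (- Z) _ _ _).
rewrite mulrN mulNr mulrNN EZ ZE in Dm; have {}Dm := Dm erefl erefl ZZ.
move: Dp Dm; set a := \rank _; set b := \rank _.
rewrite !mxtraceZ !mxtraceD raddfN /= => Dp Dm.
have trE : \tr E = a%:R + b%:R by rewrite -Dp -Dm; field.
have trZ : \tr Z = a%:R - b%:R by rewrite -Dp -Dm; field.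
exists (Posz a - Posz b).
  by rewrite rmorphB /= -trZ mxtraceZ mulrC mulrA divff ?mul1r.
rewrite rmorphB /= trE (le_trans (ler_normB _ _)) // !normr_nat.
by [].
Qed.
(** The trace is an integer multiple of an imaginary square root of -x; being real, it is zero. *)
Lemma mxtrace_negsqrt_idem n (E Y : 'M[algC]_n.+1) (x : algC) :
  0 < x -> E * E = E -> E * Y = Y -> Y * E = Y -> Y * Y = - x *: E ->
  \tr Y \is Num.real -> \tr Y = 0.
Proof.
move=> x_gt0 EE EY YE YY Y_real; have r2 : sqrtC (- x) ^+ 2 = - x by rewrite sqrtCK.
have r0 : sqrtC (- x) != 0 by rewrite sqrtC_eq0 oppr_eq0 gt_eqF.
rewrite -r2 in YY; have [c trY _] := mxtrace_root_idem r0 EE EY YE YY.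
have : 0 <= \tr Y ^+ 2 by rewrite real_exprn_even_ge0.
rewrite trY exprMn r2 mulrN oppr_ge0 pmulr_lle0 // => c2_le0.
have [->|c0] := eqVneq c 0; first by rewrite mulr0z mul0r.
have : 0 < c%:~R ^+ 2 :> algC by rewrite real_exprn_even_gt0 ?realz ?intr_eq0.
by rewrite (le_gtF c2_le0).
Qed.

(** * Spectral projections of a matrix of finite order *)

Section EigenProjection.

Variables (F : numClosedFieldType) (n : nat) (P : 'M[F]_n.+1) (N : nat).
Hypotheses (N_gt0 : (0 < N)%N) (PN : P ^+ N = 1).

(** For z^N = 1, a Fourier average over the powers of [P]: the projection onto the eigenspace of [z]
    along the other eigenspaces. *)
Definition eigproj (z : F) : 'M[F]_n.+1 :=
  N%:R^-1 *: \sum_(j < N) z^-1 ^+ j *: P ^+ j.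

Lemma unity_neq0 (z : F) : z ^+ N = 1 -> z != 0.
Proof. by apply: contra_eq_neq => ->; rewrite expr0n gtn_eqF // eq_sym oner_neq0. Qed.

Lemma unity_norm (z : F) : z ^+ N = 1 -> `|z| = 1.
Proof.
move=> zN; have /eqP := congr1 Num.norm zN.
by rewrite normrX normr1 pexpr_eq1 // => /eqP.
Qed.

Lemma natr_N_neq0 : N%:R != 0 :> F.
Proof. by rewrite pnatr_eq0 -lt0n. Qed.

Lemma mul_eigproj z : z ^+ N = 1 -> P * eigproj z = z *: eigproj z.
Proof.
move=> zN; have z0 := unity_neq0 zN.
rewrite /eigproj -scalerAr scalerA mulrC -scalerA; congr (_ *: _).
pose g j : 'M[F]_n.+1 := z *: (z^-1 ^+ j *: P ^+ j).
have -> : P * \sum_(j < N) z^-1 ^+ j *: P ^+ j = \sum_(j < N) g j.+1.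
  rewrite mulr_sumr; apply: eq_bigr => j _.
  by rewrite /g -scalerAr -exprS scalerA (exprS z^-1) mulrA divff ?mul1r.
(* Multiplication by [P] shifts the index; the last term wraps round to the first because P^N = 1
   and z^N = 1. *)
rewrite scaler_sumr -/(g _); case: (N) zN PN => [|N'] zN' PN'; first by rewrite !big_ord0.
rewrite big_ord_recr [RHS]big_ord_recl addrC; congr (_ + _).
by rewrite /g PN' exprVn zN' invr1 !expr0.
Qed.

Lemma eigproj_comm X z : GRing.comm X P -> GRing.comm X (eigproj z).
Proof.
move=> XP; rewrite /GRing.comm /eigproj -scalerAr -scalerAl; congr (_ *: _).
apply: commr_sum => j _; rewrite /GRing.comm -scalerAr -scalerAl; congr (_ *: _).
exact: commrX.
Qed.

Lemma mul_eigproj_id z X : z ^+ N = 1 -> P * X = z *: X -> eigproj z * X = X.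
Proof.
move=> zN PX; have PXj j : P ^+ j * X = z ^+ j *: X.
  elim: j => [|j IHj]; first by rewrite !expr0 mul1r scale1r.
  by rewrite exprSr -mulrA PX -scalerAr IHj scalerA -exprS.
rewrite /eigproj -scalerAl mulr_suml (eq_bigr (fun=> X)) => [|j _].
  by rewrite sumr_const card_ord -scaler_nat scalerA mulVf ?natr_N_neq0 ?scale1r.
by rewrite -scalerAl PXj scalerA -exprMn mulVf ?unity_neq0 // expr1n scale1r.
Qed.

Lemma eigproj_idem z : z ^+ N = 1 -> eigproj z * eigproj z = eigproj z.
Proof. by move=> zN; apply: mul_eigproj_id => //; apply: mul_eigproj. Qed.

Lemma sum_eigproj w : N.-primitive_root w -> \sum_(i < N) eigproj (w ^+ i) = 1.
Proof.
move=> prim_w; rewrite -scaler_sumr exchange_big /=.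
(* Geometric sums of roots of unity vanish, so that only the term P^0 survives. *)
have geom j : (j < N)%N -> \sum_(i < N) (w ^+ i)^-1 ^+ j = (N * (j == 0))%:R.
  move=> ltjN; case: eqP => [->|/eqP j0].
    by rewrite (eq_bigr (fun=> 1)) => [|i _]; rewrite ?expr0 // sumr_const card_ord muln1.
  have wj1 : w^-1 ^+ j - 1 != 0.
    rewrite subr_eq0 exprVn invr_eq1 -(prim_order_dvd prim_w).
    by rewrite gtnNdvd // lt0n.
  apply: (mulfI wj1); rewrite muln0 mulr0.
  rewrite (eq_bigr (fun i : 'I_N => (w^-1 ^+ j) ^+ i)) => [|i _]; last first.
    by rewrite -exprVn -!exprM mulnC.
  rewrite -subrX1 -exprM mulnC exprM exprVn (prim_expr_order prim_w).
  by rewrite invr1 expr1n subrr.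
rewrite -[RHS]scale1r -[X in X *: 1](mulVf natr_N_neq0) -scalerA; congr (_ *: _).
case: N N_gt0 geom prim_w => // N' _ geom prim_w.
rewrite big_ord_recl [X in _ + X]big1 => [|j _]; last first.
  by rewrite -scaler_suml geom // muln0 scale0r.
by rewrite -scaler_suml geom // muln1 addr0 expr0.
Qed.

Lemma mxtrace_eigproj X z : \tr (X * eigproj z)
  = N%:R^-1 * \sum_(j < N) z^-1 ^+ j * \tr (X * P ^+ j).
Proof.
rewrite /eigproj -scalerAr mxtraceZ; congr (_ * _).
rewrite mulr_sumr raddf_sum; apply: eq_bigr => j _ /=.
by rewrite -scalerAr mxtraceZ.
Qed.

(** The triangle inequality in [mxtrace_eigproj]: |z| = 1 and the traces being weighted are
    nonnegative. *)
Lemma norm_mxtrace_eigproj X z : z ^+ N = 1 ->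
  (forall j, 0 <= \tr (X * P ^+ j)) -> `|\tr (X * eigproj z)| <= \tr (X * eigproj 1).
Proof.
move=> zN X_ge0; rewrite !mxtrace_eigproj normrM ger0_norm ?invr_ge0 ?ler0n //.
apply: ler_wpM2l; first by rewrite invr_ge0 ler0n.
apply: le_trans (ler_norm_sum _ _ _) _; apply: ler_sum => j _.
by rewrite invr1 expr1n mul1r normrM normrX normfV unity_norm // invr1 expr1n mul1r ger0_norm.
Qed.

End EigenProjection.

(** * Eigenvalues of permutation matrices *)

Lemma perm_mxX (R : pzRingType) n (s : {perm 'I_n.+1}) j :
  perm_mx (s ^+ j)%g = perm_mx s ^+ j :> 'M[R]_n.+1.
Proof.
elim: j => [|j IHj]; first by rewrite expg0 perm_mx1.
by rewrite expgS perm_mxM IHj exprS.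
Qed.

(** Choose a nonzero entry of [M], in row [i], and let l be the length of the orbit of [i]. Since
    s^l fixes [i], that entry equals z^l times itself. *)
Lemma perm_eigenvalue_order (F : fieldType) n (s : {perm 'I_n.+1}) (z : F) (M : 'M[F]_n.+1) :
  perm_mx s * M = z *: M -> M != 0 ->
  exists2 l, (0 < l <= n.+1)%N & z ^+ l = 1.
Proof.
move=> sM; case/matrix0Pn=> i [j Mij].
have sMl l : perm_mx (s ^+ l)%g * M = z ^+ l *: M.
  elim: l => [|l IHl]; first by rewrite expg0 perm_mx1 scale1r mul1r.
  by rewrite expgSr perm_mxM -mulrA sM -scalerAr IHl scalerA -exprS.
exists #|porbit s i|.
  by rewrite lt0n card_porbit_neq0 -[X in (_ <= X)%N](card_ord n.+1) max_card.
have := congr1 (fun X : 'M_n.+1 => X i j) (sMl #|porbit s i|).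
rewrite -mulmxE -row_permE !mxE permX iter_porbit -[LHS]mul1r => zl.
by apply: (mulIf Mij); rewrite -zl.
Qed.

Lemma prime_dvd_fact p n : prime p -> (p %| n`!)%N -> (p <= n)%N.
Proof.
move=> p_pr; elim: n => [|n IHn]; first by rewrite dvdn1 => /eqP p1; rewrite p1 in p_pr.
rewrite factS Euclid_dvdM // => /orP[/dvdn_leq->//|/IHn/leqW //].
Qed.

(** * The in-regular case: traces of [B] on the eigenspaces of [P] *)

Section Spectrum.

Variables (d n : nat) (A : 'M[algC]_n.+1) (s : {perm 'I_n.+1}).
Let P : 'M[algC]_n.+1 := perm_mx s.
Let J : 'M[algC]_n.+1 := const_mx 1.
(** A common exponent for all permutations of the vertices, with no prime factor above 32. *)
Let N := n.+1`!.
Let B : 'M[algC]_n.+1 := 2 *: A + 1.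
Hypothesis order_eq : n.+1 = (d * d + d + 2)%N.
Hypothesis order_le : (n.+1 <= 32)%N.
Hypothesis A_nat : forall i j, A i j \is a Num.nat.
Hypothesis mxtraceA : \tr A = 0.
Hypothesis AJ : A * J = d%:R *: J.
Hypothesis JA : J * A = d%:R *: J.
Hypothesis AP : A * P = P * A.
Hypothesis AA : A * A + A + 1 = J - P.

Let N_gt0 : (0 < N)%N. Proof. exact: fact_gt0. Qed.

Let PN : P ^+ N = 1.
Proof.
rewrite -perm_mxX; have -> : (s ^+ N = 1)%g.
  by apply/eqP; rewrite -order_dvdn /N -card_Sn -cardsT order_dvdG ?inE.
exact: perm_mx1.
Qed.

Let PJ : P * J = J.
Proof. by apply/matrixP=> i j; rewrite -mulmxE -row_permE !mxE. Qed.

Let JP : J * P = J.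
Proof. by apply/matrixP=> i j; rewrite -mulmxE /P -[s]invgK -col_permE !mxE. Qed.

Let JJ : J * J = n.+1%:R *: J.
Proof.
apply/matrixP=> i j; rewrite !mxE (eq_bigr (fun=> 1)) => [|k _].
  by rewrite sumr_const card_ord mulr1.
by rewrite !mxE mulr1.
Qed.

Let BP : B * P = P * B.
Proof. by rewrite mulrDl mulrDr -scalerAl -scalerAr AP mul1r mulr1. Qed.

Let BJ : B * J = (2 * d + 1)%:R *: J.
Proof. by rewrite mulrDl -scalerAl AJ mul1r scalerA -{2}[J]scale1r -scalerDl natrD natrM. Qed.

Let JB : J * B = (2 * d + 1)%:R *: J.
Proof. by rewrite mulrDr -scalerAr JA mulr1 scalerA -{2}[J]scale1r -scalerDl natrD natrM. Qed.

Let BB : B * B = 4 *: J - 4 *: P - 3 *: 1.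
Proof.
have -> : B * B = 4 *: (A * A + A + 1) - 3 *: 1.
  rewrite mulrDl mulrDr -!scalerAl -scalerAr mul1r !mulr1 !scalerDr scalerA.
  apply/matrixP=> i j; rewrite !mxE; ring.
by rewrite AA scalerBr.
Qed.

Lemma mxtrace_mulP_nat (X : 'M[algC]_n.+1) k :
  (forall i j, X i j \is a Num.nat) -> \tr (X * P ^+ k) \is a Num.nat.
Proof.
move=> X_nat; apply: rpred_sum => i _; rewrite -perm_mxX mxE.
by apply: rpred_sum => j _; rewrite rpredM // !mxE rpred_nat.
Qed.

Let B_nat i j : B i j \is a Num.nat.
Proof. by rewrite !mxE rpredD ?rpredM ?rpred_nat. Qed.

Local Notation pi := (eigproj P N).

(** On the image of [E], the formula for B^2 reduces to the scalar -4z - 3 = r^2. *)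
Lemma mxtrace_B_sqrt z r (E : 'M[algC]_n.+1) :
  r ^+ 2 = - 3 - 4 * z -> r != 0 -> E * E = E -> B * E = E * B -> J * E = 0 ->
  P * E = z *: E -> exists2 c : int, \tr (B * E) = c%:~R * r & `|c%:~R| <= \tr E.
Proof.
move=> r2 r0 EE BE JE PE; apply: mxtrace_root_idem => //.
- by rewrite mulrA -BE -mulrA EE.
- by rewrite -mulrA EE.
rewrite -mulrA [E * _]mulrA -BE -mulrA EE mulrA BB !mulrBl -!scalerAl JE PE mul1r.
by rewrite r2 scaler0 sub0r scalerA scalerBl scaleNr addrC.
Qed.

Lemma J_eigproj z : z ^+ N = 1 -> z != 1 -> J * pi z = 0.
Proof.
move=> zN z1; have : (1 - z) *: (J * pi z) = 0.
  rewrite scalerBl scale1r {1}scalerAr -(mul_eigproj N_gt0 PN zN).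
  by rewrite mulrA JP subrr.
by move/eqP; rewrite scaler_eq0 subr_eq0 eq_sym (negPf z1) => /eqP.
Qed.

Lemma mxtrace_B_eigproj z r : z ^+ N = 1 -> z != 1 -> r ^+ 2 = - 3 - 4 * z -> r != 0 ->
  exists2 c : int, \tr (B * pi z) = c%:~R * r & `|c%:~R| <= \tr (pi z).
Proof.
move=> zN z1 r2 r0; apply: (mxtrace_B_sqrt r2 r0).
- exact: (eigproj_idem N_gt0 PN zN).
- exact: (eigproj_comm _ _ BP).
- exact: J_eigproj.
- exact: (mul_eigproj N_gt0 PN zN).
Qed.

(** The all-ones vector contributes 2d + 1. On the rest of the eigenspace B^2 = -7, and there the
    trace is real, hence zero. *)
Lemma mxtrace_B_eigproj1 : \tr (B * pi 1) = (2 * d + 1)%:R.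
Proof.
pose v := n.+1%:R : algC; have v0 : v != 0 by rewrite pnatr_eq0.
(* Removes the all-ones line, so that [J] vanishes on what remains. *)
pose E := pi 1 - v^-1 *: J.
have zN : (1 : algC) ^+ N = 1 by rewrite expr1n.
have pJ : pi 1 * J = J by apply: (mul_eigproj_id N_gt0 zN); rewrite PJ scale1r.
have Jp : J * pi 1 = J by rewrite (eigproj_comm (P := P)) // /GRing.comm JP PJ.
have JE : J * E = 0 by rewrite mulrBr Jp -(scalerAr _ _ J) JJ scalerA mulVf // scale1r subrr.
have EE : E * E = E.
  transitivity ((pi 1 - v^-1 *: J) * E) => //; rewrite mulrBl -(scalerAl _ J) JE scaler0 subr0.
  by rewrite mulrBr -(scalerAr _ _ J) pJ (eigproj_idem N_gt0 PN).
have BE : B * E = E * B.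
  by rewrite mulrBr mulrBl -(scalerAl _ J) -(scalerAr _ _ J) BJ JB (eigproj_comm _ _ BP).
have PE : P * E = 1 *: E.
  by rewrite mulrBr -(scalerAr _ _ J) PJ (mul_eigproj N_gt0 PN zN) !scale1r.
have trBpi : \tr (B * pi 1) = \tr (B * E) + (2 * d + 1)%:R.
  rewrite mulrBr raddfB /= -(scalerAr _ _ J) BJ scalerA mxtraceZ.
  rewrite [\tr J](eq_bigr (fun=> 1)) => [|i _]; last by rewrite mxE.
  by rewrite sumr_const card_ord -/v mulrAC mulVf // mul1r subrK.
have real_trBE : \tr (B * E) \is Num.real.
  rewrite -[X in X \is _](addrK (2 * d + 1)%:R) -trBpi rpredB ?realn //.
  rewrite mxtrace_eigproj rpredM ?rpredV ?realn // rpred_sum // => j _.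
  by rewrite invr1 expr1n mul1r Rreal_nat // mxtrace_mulP_nat // => ? ?; apply: B_nat.
have EB : E * (B * E) = B * E by rewrite mulrA -BE -mulrA EE.
have YY : B * E * (B * E) = - 7 *: E.
  by rewrite -mulrA EB mulrA BB !mulrBl -!scalerAl JE PE mul1r scaler0 sub0r
    scale1r -opprD -scalerDl scaleNr -natrD.
have BEE : B * E * E = B * E by rewrite -mulrA EE.
by rewrite trBpi (mxtrace_negsqrt_idem _ EE EB BEE YY) ?add0r.
Qed.

Lemma mxtrace_eigproj_le (X : 'M[algC]_n.+1) z : z ^+ N = 1 ->
  (forall i j, X i j \is a Num.nat) -> `|\tr (X * pi z)| <= \tr (X * pi 1).
Proof.
move=> zN X_nat; apply: (norm_mxtrace_eigproj N_gt0) => // j.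
by rewrite natr_ge0 // mxtrace_mulP_nat.
Qed.

Let m := \tr (pi 1).
Let t := \tr (A * pi 1).

Lemma mxtrace_eigproj_rank z : z ^+ N = 1 -> \tr (pi z) = (\rank (pi z))%:R.
Proof. by move=> zN; apply: mxtrace_idem; apply: (eigproj_idem N_gt0 PN zN). Qed.

Lemma mxtrace_eigproj_le1 z : z ^+ N = 1 -> `|\tr (pi z)| <= m.
Proof.
move=> zN; rewrite /m -[X in \tr X]mul1r -[X in _ <= \tr X]mul1r.
by apply: mxtrace_eigproj_le => // i j; rewrite !mxE rpred_nat.
Qed.

Lemma mxtrace_B_split z : \tr (B * pi z) = 2 * \tr (A * pi z) + \tr (pi z).
Proof. by rewrite mulrDl mul1r mxtraceD -(scalerAl _ A) mxtraceZ. Qed.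

Let m_ge0 : 0 <= m.
Proof. by apply: le_trans (normr_ge0 _) (mxtrace_eigproj_le1 (expr1n _ _)). Qed.

Let t_ge0 : 0 <= t.
Proof. exact: le_trans (normr_ge0 _) (mxtrace_eigproj_le (expr1n _ _) A_nat). Qed.

Lemma mxtrace_B_eigprojN1 : (-1 : algC) ^+ N = 1 -> 'Re (\tr (B * pi (-1))) <= m.
Proof.
move=> zN; have z1 : -1 != 1 :> algC by rewrite lt_eqF // (lt_trans (ltrN10 _) ltr01).
have r2 : 1 ^+ 2 = - 3 - 4 * -1 :> algC by ring.
have [c -> c_le] := mxtrace_B_eigproj zN z1 r2 (oner_neq0 _).
rewrite mulr1 (Creal_ReP _ _) ?realz //.
apply: le_trans (real_ler_norm _) (le_trans c_le _); first by rewrite realz.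
by rewrite -[X in X <= _]ger0_norm ?mxtrace_eigproj_le1 // mxtrace_eigproj_rank.
Qed.

(** The trace is c(1 - 2z) with [c] an integer, which is its real part. The corresponding trace of
    [A] is x - cz with x real; its modulus is at least |c| and at most [t]. *)
Lemma mxtrace_B_eigproji z : z ^+ N = 1 -> z ^+ 2 = -1 -> 'Re (\tr (B * pi z)) <= t.
Proof.
move=> zN z2; have z1 : z != 1.
  by apply: contra_eq_neq z2 => ->; rewrite expr1n gt_eqF // (lt_trans (ltrN10 _) ltr01).
have r2 : (1 - 2 * z) ^+ 2 = - 3 - 4 * z by ring: z2.
have r0 : 1 - 2 * z != 0.
  (* If 1 - 2z vanished, so would 2(1 - 2z) - (1 - 2z)^2, which is 5. *)
  apply/eqP=> r0; have : (5 : algC) = 0.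
    by transitivity (2 * (1 - 2 * z) - (- 3 - 4 * z)); [ring | rewrite -r2 r0; ring].
  by move/eqP; rewrite pnatr_eq0.
have [c trB c_le] := mxtrace_B_eigproj zN z1 r2 r0.
have z_conj : z^* = - z.
  apply: (mulfI (unity_neq0 N_gt0 zN)).
  by rewrite -normCK (unity_norm N_gt0 zN) mulrN -expr2 z2 opprK expr1n.
have c_conj : c%:~R^* = c%:~R :> algC by rewrite conj_Creal ?realz.
have -> : 'Re (\tr (B * pi z)) = c%:~R.
  rewrite ReE trB rmorphM rmorphB rmorphM rmorph1 rmorph_nat /= z_conj c_conj.
  by field.
pose x : algC := (c%:~R - (\rank (pi z))%:R) / 2.
have trA : \tr (A * pi z) = x - c%:~R * z.
  have := mxtrace_B_split z; rewrite trB mxtrace_eigproj_rank // => trBA.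
  have two0 : 2 != 0 :> algC by rewrite pnatr_eq0.
  by apply: (mulfI two0); rewrite -[LHS](addrK (\rank (pi z))%:R) -trBA /x; field.
have x_real : x \is Num.real by rewrite rpredM ?rpredB ?realz ?rpredV ?realn.
have : `|\tr (A * pi z)| ^+ 2 = x ^+ 2 + c%:~R ^+ 2.
  rewrite normCK trA rmorphB rmorphM /= z_conj c_conj conj_Creal //.
  by transitivity (x ^+ 2 - c%:~R ^+ 2 * z ^+ 2); [ring | rewrite z2; ring].
move=> normA; have c2_le : c%:~R ^+ 2 <= t ^+ 2.
  apply: le_trans (_ : `|\tr (A * pi z)| ^+ 2 <= _); last first.
    by rewrite ler_pXn2r ?nnegrE ?t_ge0 // mxtrace_eigproj_le.
  by rewrite normA lerDr real_exprn_even_ge0.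
apply: le_trans (real_ler_norm _) _; first by rewrite realz.
rewrite -(@ler_pXn2r _ 2) ?nnegrE ?t_ge0 //.
by rewrite real_normK ?realz.
Qed.

(** N times the trace is an integer polynomial in [z] whose square is (Nc)^2 (-3 - 4z), so a prime p
    > 32 divides Nc. It does not divide [N], and |c| is at most a rank, hence below p; so c = 0. *)
Lemma mxtrace_B_eigproj0 z k : k.-primitive_root z -> z ^+ N = 1 -> (2 < k)%N -> k != 4%N ->
  \tr (B * pi z) = 0.
Proof.
move=> prim_z zN k_gt2 k4.
have [pi0|pi_neq0] := eqVneq (pi z) 0; first by rewrite pi0 mulr0 mxtrace0.
have z1 : z != 1.
  apply/eqP=> z_eq1; have := prim_order_dvd prim_z 1.
  by rewrite z_eq1 expr1n eqxx dvdn1 => /eqP k1; rewrite k1 in k_gt2.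
(* The table of witnesses stops at 32, and no eigenvalue of [P] has larger order. *)
have k_le : (k <= 32)%N.
  have [l l_range /eqP zl] := perm_eigenvalue_order (mul_eigproj N_gt0 PN zN) pi_neq0.
  case/andP: l_range => l_gt0 l_le; apply: leq_trans (leq_trans l_le order_le).
  by rewrite dvdn_leq // (prim_order_dvd prim_z).
have [r r2] : exists r : algC, r ^+ 2 = - 3 - 4 * z by exists (sqrtC (- 3 - 4 * z)); rewrite sqrtCK.
(* Otherwise |4z| = 3, although |z| = 1. *)
have r0 : r != 0.
  apply/eqP=> r_eq0; have z34 : - 3 - 4 * z = 0 by rewrite -r2 r_eq0 expr0n.
  have /(congr1 Num.norm) : 4 * z = - 3 by rewrite -[RHS]subr0 -z34; ring.
  by rewrite normrM (unity_norm N_gt0 zN) mulr1 normrN !normr_nat => /eqP; rewrite eqr_nat.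
have [c trB c_le] := mxtrace_B_eigproj zN z1 r2 r0.
have [b b_def] : exists b : nat -> nat, forall j, \tr (B * P ^+ j) = (b j)%:R.
  exists (fun j => Num.trunc (\tr (B * P ^+ j))) => j.
  by rewrite truncnK // mxtrace_mulP_nat // => ? ?; apply: B_nat.
(* The inverse of [z] is z^(k - 1), which keeps the exponents nonnegative. *)
pose F : {poly int} := \sum_(j < N) (b j)%:R *: 'X^(k.-1 * j).
have Fz : (map_poly intr F).[z] = N%:R * \tr (B * pi z).
  rewrite mxtrace_eigproj mulrA divff ?mul1r; last by rewrite pnatr_eq0 -lt0n N_gt0.
  rewrite rmorph_sum /= horner_sum; apply: eq_bigr => j _.
  rewrite map_polyZ /= map_polyXn !hornerE b_def rmorph_nat mulrC; congr (_ * _).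
  have zk : z^-1 = z ^+ k.-1.
    apply: (mulIf (unity_neq0 N_gt0 zN)); rewrite mulVf ?(unity_neq0 N_gt0 zN) //.
    by rewrite -exprSr prednK ?prim_expr_order // (leq_trans _ k_gt2).
  by rewrite zk -exprM.
have [||p [p_pr p_gt32]] := @nonsquare_cyclotomic k z F (N%:Z * c) prim_z _ k4.
- by rewrite k_gt2.
- by rewrite Fz trB rmorphM /= !exprMn r2 !mulrA.
rewrite abszM Euclid_dvdM //= => /orP[p_dvd_fact|p_dvd_c].
  by have := prime_dvd_fact p_pr p_dvd_fact; lia.
have c_lt : (`|c| < p)%N.
  apply: leq_ltn_trans (_ : \rank (pi z) < p)%N; last first.
    by have := rank_leq_row (pi z); lia.
  by rewrite -(ler_nat algC) natr_absz intr_norm -mxtrace_eigproj_rank.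
have c0 : c = 0.
  by apply/eqP; rewrite -absz_eq0 -leqn0 leqNgt; apply/negP=> /dvdn_leq/(_ p_dvd_c);
    rewrite leqNgt c_lt.
by rewrite trB c0 mulr0z mul0r.
Qed.

Lemma degree_le3 : (d <= 3)%N.
Proof.
have [w prim_w] := C_prim_root_exists N_gt0.
have wN i : (w ^+ i) ^+ N = 1 by rewrite exprAC (prim_expr_order prim_w) expr1n.
(* A majorant of the real part of the trace of [B] on each eigenspace, zero except at 1, -1, i and
   -i. *)
pose h (z : algC) : algC := (z == 1)%:R * (2 * d + 1)%:R + (z == -1)%:R * m
  + ((z == 'i)%:R + (z == - 'i)%:R) * t.
have h_ge0 z : 0 <= h z.
  by rewrite !addr_ge0 // mulr_ge0 ?addr_ge0 ?ler0n ?m_ge0 ?t_ge0.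
have Re_le z : z ^+ N = 1 -> 'Re (\tr (B * pi z)) <= h z.
  move=> zN; have [k prim_z _] := prim_order_exists N_gt0 zN.
  have k_gt0 := prim_order_gt0 prim_z.
  have [k_gt2|k_le2] := ltnP 2 k.
    have [k4|k4] := eqVneq k 4%N; last first.
      by rewrite (mxtrace_B_eigproj0 prim_z) // (Creal_ReP _ _) ?rpred0 ?h_ge0.
    have z4 : z ^+ 4 = 1 by rewrite -k4 prim_expr_order.
    have z2 : z ^+ 2 = -1.
      have := prim_order_dvd prim_z 2; rewrite k4 => /esym z2_neq1.
      by have /eqP := z4; rewrite (exprM z 2 2) sqrf_eq1 z2_neq1 => /eqP.
    apply: le_trans (mxtrace_B_eigproji zN z2) _.
    have : (z == 'i) || (z == - 'i) by rewrite -eqf_sqr z2 sqrCi.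
    move=> zi; have i_ge1 : 1 <= (z == 'i)%:R + (z == - 'i)%:R :> algC.
      by case/orP: zi => ->; rewrite ?lerDl ?lerDr ler0n.
    rewrite /h; apply: le_trans (_ : 1 * t <= _); first by rewrite mul1r.
    apply: le_trans (ler_wpM2r t_ge0 i_ge1) _; rewrite lerDr.
    by rewrite addr_ge0 // mulr_ge0 ?ler0n ?m_ge0.
  have [k1|k2] : k = 1%N \/ k = 2%N by lia.
    have -> : z = 1 by rewrite -(prim_expr_order prim_z) k1.
    rewrite mxtrace_B_eigproj1 (Creal_ReP _ _) ?realn // /h eqxx mul1r -addrA lerDl.
    by rewrite addr_ge0 // mulr_ge0 ?addr_ge0 ?ler0n ?m_ge0 ?t_ge0.
  have zN1 : z = -1.
    have := prim_order_dvd prim_z 1; rewrite k2 => /esym z_neq1.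
    by have /eqP := prim_expr_order prim_z; rewrite k2 sqrf_eq1 -[z in z == 1]expr1 z_neq1 => /eqP.
  rewrite zN1 in zN *; apply: le_trans (mxtrace_B_eigprojN1 zN) _.
  rewrite /h eqxx mul1r addrAC lerDr.
  by rewrite addr_ge0 // mulr_ge0 ?addr_ge0 ?ler0n ?t_ge0.
(* The multiplicity of [x] among the powers of [w], at most 1 as [w] is primitive. *)
pose cnt (x : algC) : algC := \sum_(i < N) (w ^+ i == x)%:R.
have cnt_le x : cnt x <= 1.
  have -> : cnt x = #|[pred i : 'I_N | w ^+ i == x]|%:R.
    rewrite -sum1_card big_mkcond natr_sum; apply: eq_bigr => i _.
    by rewrite inE; case: eqP.
  rewrite lern1.
  apply/card_le1_eqP => i j; rewrite !inE => /eqP <- /eqP/esym/eqP.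
  by rewrite (eq_prim_root_expr prim_w) !modn_small ?ltn_ord // => /eqP/val_inj.
have sum_h : \sum_(i < N) h (w ^+ i) = cnt 1 * (2 * d + 1)%:R + cnt (-1) * m
  + (cnt 'i + cnt (- 'i)) * t.
  by rewrite !big_split -!mulr_suml big_split.
have trB : \tr B = n.+1%:R by rewrite mxtraceD mxtraceZ mxtraceA mulr0 add0r mxtrace1.
have trBsum : \tr B = \sum_(i < N) \tr (B * pi (w ^+ i)).
  by rewrite -raddf_sum -mulr_sumr (sum_eigproj P N_gt0 prim_w) mulr1.
have Re_trB : 'Re (\tr B) = n.+1%:R by rewrite trB (Creal_ReP _ _) ?realn.
have : n.+1%:R <= \sum_(i < N) h (w ^+ i).
  by rewrite -Re_trB trBsum raddf_sum; apply: ler_sum => i _; apply: Re_le.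
rewrite sum_h => n_le; have {}n_le : n.+1%:R <= (2 * d + 1)%:R + m + (1 + 1) * t :> algC.
  apply: le_trans n_le _; apply: lerD; first apply: lerD.
  - by rewrite ler_piMl ?ler0n.
  - by rewrite ler_piMl ?m_ge0.
  by rewrite ler_wpM2r ?t_ge0 // lerD.
have : n.+1%:R <= (2 * (2 * d + 1))%:R :> algC.
  have g1 := mxtrace_B_eigproj1; rewrite mxtrace_B_split -/t -/m in g1.
  by apply: le_trans n_le _; rewrite natrM -g1 le_eqVlt; apply/orP; left; apply/eqP; ring.
(* What remains is d^2 + d + 2 <= 4d + 2. *)
rewrite ler_nat order_eq; nia.
Qed.

End Spectrum.

(** * The case where all outliers have the same out-neighbourhood *)

Lemma mxtrace_cube_root1 n (Q : 'M[algC]_n.+1) :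
  Q * Q * Q = - (Q * Q) - Q -> \tr (Q - Q * Q) \is Num.real -> \tr (Q - Q * Q) = 0.
Proof.
move=> Q3; have Q4 : Q * Q * (Q * Q) = Q.
  by rewrite mulrA Q3 mulrBl mulNr Q3 opprD !opprK addrAC subrr add0r.
have Q3' : Q * (Q * Q) = - (Q * Q) - Q by rewrite mulrA.
have expand x y z t : (x *: Q + y *: (Q * Q)) * (z *: Q + t *: (Q * Q))
    = (y * t - x * t - y * z) *: Q + (x * z - x * t - y * z) *: (Q * Q).
  rewrite !(mulrDl, mulrDr) -!scalerAl -!scalerAr !scalerA Q4 Q3 Q3'.
  by apply/matrixP=> i j; rewrite !mxE; ring.
have Yeq : Q - Q * Q = 1 *: Q + -1 *: (Q * Q) by rewrite scaleN1r scale1r.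
(* The idempotent is -(Q + Q^2), on whose image [Q] is annihilated by Q^2 + Q + 1; there (Q - Q^2)^2
   = -3. *)
apply: (@mxtrace_negsqrt_idem _ (-1 *: Q + -1 *: (Q * Q)) _ 3); first by rewrite ltr0n.
all: rewrite ?Yeq expand ?scalerDr ?scalerA; congr (_ *: _ + _ *: _); ring.
Qed.

(** All rows of K = A^3 + A^2 + A are equal, so K/c is an idempotent [E] of trace 1, with c = d^3 +
    d^2 + d. Then Q = A - dE satisfies Q^3 + Q^2 + Q = 0, so tr(Q - Q^2) = 0; but this trace is d^2
    - d. *)
Lemma no_constant_cubic (d n : nat) (A : 'M[algC]_n.+1) (k : 'I_n.+1 -> algC) :
  (1 < d)%N -> A * const_mx 1 = d%:R *: (const_mx 1 : 'M_n.+1) ->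
  \tr A = 0 -> \tr (A * A) = 0 ->
  (forall i j, (A * A * A + A * A + A) i j = k j) -> False.
Proof.
move=> d_gt1 AJ trA trAA Kk; pose K := A * A * A + A * A + A; pose c : algC := \sum_j k j.
have AK : A * K = d%:R *: K.
  apply/matrixP=> i j; rewrite [LHS]mxE [RHS]mxE Kk.
  under eq_bigr do rewrite Kk.
  rewrite -mulr_suml; congr (_ * _); have /matrixP/(_ i i) := AJ.
  by rewrite !mxE mulr1 => <-; apply: eq_bigr => l _; rewrite mxE mulr1.
have KA : K * A = d%:R *: K by rewrite -AK /K !(mulrDl, mulrDr) !mulrA.
have KK : K * K = c *: K.
  apply/matrixP=> i j; rewrite [LHS]mxE [RHS]mxE Kk mulr_suml.
  by apply: eq_bigr => l _; rewrite !Kk.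
have c_eq : c = d%:R ^+ 3 + d%:R ^+ 2 + d%:R.
  have : K * const_mx 1 = (d%:R ^+ 3 + d%:R ^+ 2 + d%:R) *: (const_mx 1 : 'M_n.+1).
    rewrite /K !mulrDl -!mulrA AJ -!scalerAr !AJ -!scalerAr !AJ !scalerA -!scalerDl.
    by congr (_ *: _); ring.
  move/matrixP/(_ ord0 ord0); rewrite [LHS]mxE [RHS]mxE mxE mulr1 => <-.
  by apply: eq_bigr => l _; rewrite Kk mxE mulr1.
have c0 : c != 0.
  by rewrite c_eq -!natrX -!natrD pnatr_eq0; lia.
pose E := c^-1 *: K.
have cE : c *: E = K by rewrite scalerA divff // scale1r.
have EE : E * E = E by rewrite -scalerAl -scalerAr KK scalerA scalerA mulfVK.
have AE : A * E = d%:R *: E by rewrite -scalerAr AK !scalerA mulrC.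
have EA : E * A = d%:R *: E by rewrite -scalerAl KA !scalerA mulrC.
have trE : \tr E = 1.
  rewrite mxtraceZ /mxtrace (eq_bigr k) => [|i _]; last by rewrite Kk.
  by rewrite mulVf.
pose Q := A - d%:R *: E.
have QE : Q * E = 0 by rewrite mulrBl AE -(scalerAl _ E) EE subrr.
have QQ : Q * Q = A * A - d%:R ^+ 2 *: E.
  transitivity (Q * (A - d%:R *: E)) => //.
  rewrite mulrBr -(scalerAr _ _ E) QE scaler0 subr0 mulrBl.
  by rewrite -(scalerAl _ E) EA scalerA.
have QQQ : Q * Q * Q = - (Q * Q) - Q.
  transitivity (Q * Q * (A - d%:R *: E)) => //.
  rewrite mulrBr -(scalerAr _ _ E) -(mulrA Q Q E) QE mulr0 scaler0 subr0 QQ.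
  rewrite mulrBl -(scalerAl _ E) EA scalerA.
  have : A * A * A = c *: E - A * A - A by rewrite cE /K addrAC addrK addrK.
  by move=> ->; rewrite c_eq /Q; apply/matrixP=> i j; rewrite !mxE; ring.
have trQ : \tr (Q - Q * Q) = d%:R ^+ 2 - d%:R.
  by rewrite QQ /Q !raddfB /= !(mxtraceZ _ E) trE trA trAA; ring.
have trQ0 : \tr (Q - Q * Q) = 0.
  by apply: (mxtrace_cube_root1 QQQ); rewrite trQ -natrX rpredB ?realn.
move: trQ; rewrite trQ0 -natrX => /esym/eqP; rewrite subr_eq0 eqr_nat; nia.
Qed.

(** * From digraphs to complex matrices *)

Lemma excess_one_relpre (T T' : finType) (f : T' -> T) (e : rel T) (d k : nat) :
  bijective f -> excess_one_digraph e d k -> excess_one_digraph (relpre f e) d k.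
Proof.
move=> f_bij [geo [out_ge [u0 out_u0]] card_T]; have f_inj := bij_inj f_bij.
have out_deg u : out_degree (relpre f e) u = out_degree e (f u).
  rewrite /out_degree -(on_card_preimset (onW_bij _ f_bij)).
  by apply: eq_card => v; rewrite !inE.
split; last by rewrite -card_T (bij_eq_card f_bij).
  move=> u v p q wp szp wq szq; apply: (inj_map f_inj).
  by apply: (geo (f u) (f v)); rewrite ?size_map // /walk path_map last_map (inj_eq f_inj).
split=> [u|]; first by rewrite out_deg.
have [g _ gK] := f_bij; exists (g u0).
by rewrite out_deg gK.
Qed.

Lemma no_excess_one_ord (d n : nat) (e : rel 'I_n.+1) :
  (3 < d)%N -> (n.+1 <= 32)%N -> ~ excess_one_digraph e d 2.
Proof.
move=> d_gt3 n_le e_excess; have d_gt0 : (0 < d)%N by lia.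
have [o oP] := fin_all_exists (exists_outlier e_excess d_gt0).
pose A : 'M[algC]_n.+1 := \matrix_(i, j) (e i j)%:R.
pose J : 'M[algC]_n.+1 := const_mx 1.
pose P : 'M[algC]_n.+1 := \matrix_(i, j) (o i == j)%:R.
have AAE i j : (A * A) i j = (\sum_w e i w * e w j)%:R.
  by rewrite mxE natr_sum; apply: eq_bigr => w _; rewrite !mxE natrM.
have WE i j : (A * A + A + 1) i j = (walks2 e i j)%:R.
  rewrite [LHS]mxE [X in X + _]mxE AAE !mxE /walks2 !natrD -addrA addrC.
  by rewrite [RHS]addrC addrAC -addrA.
have AA : A * A + A + 1 = J - P.
  apply/matrixP=> i j; rewrite WE !mxE.
  by apply/eqP; rewrite eq_sym subr_eq -natrD oP.
have AJ : A * J = d%:R *: J.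
  apply/matrixP=> i j; rewrite !mxE mulr1 -(out_regular e_excess d_gt0 i) natr_sum.
  by apply: eq_bigr => w _; rewrite !mxE mulr1.
have trA : \tr A = 0 by apply: big1 => i _; rewrite mxE (loopless e_excess).
(* The empty walk already joins [i] to itself, so there is no closed walk of length 2. *)
have trAA : \tr (A * A) = 0.
  apply: big1 => i _; rewrite AAE; have := walks2_le1 e_excess i i.
  by rewrite /walks2 eqxx (loopless e_excess) add0n; case: (\sum_w _)%N.
have [in_reg|[S oS]] := in_regular_or_constant_outlier_row e_excess d_gt0 oP; last first.
  (* The entries of (A^2 + A + 1)A = JA - PA do not depend on the row. *)
  apply: (@no_constant_cubic d n A (fun j => (in_deg e j)%:R - (S j)%:R)) => // [|i j].
    by lia.
  have -> : A * A * A + A * A + A = (A * A + A + 1) * A by rewrite !mulrDl mul1r.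
  rewrite mxE -(walks2_step oP i j) oS natrD addrK natr_sum; apply: eq_bigr => x _.
  by rewrite WE mxE natrM.
pose s := perm (outlier_inj e_excess d_gt0 oP in_reg).
have Ps : perm_mx s = P by apply/matrixP=> i j; rewrite !mxE permE.
suff : (d <= 3)%N by rewrite leqNgt d_gt3.
apply: (@degree_le3 d n A s) => //.
- by have := card_excess_one e_excess; rewrite card_ord.
- by move=> i j; rewrite mxE rpred_nat.
- apply/matrixP=> i j; rewrite !mxE mulr1 -(in_reg j) natr_sum.
  by apply: eq_bigr => w _; rewrite !mxE mul1r.
- rewrite Ps; apply/matrixP=> i j; rewrite !mxE.
  (* After cancelling the in-degree [d], the relation says that [A] and [P] commute. *)
  have := outlier_commute e_excess d_gt0 oP i j; rewrite in_reg [RHS]addnC => /addIn comm.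
  transitivity ((\sum_w e i w * (o w == j))%:R : algC).
    by rewrite natr_sum; apply: eq_bigr => w _; rewrite !mxE natrM.
  rewrite -comm -(sum_pick (fun x => nat_of_bool (e x j)) (o i)) natr_sum.
  by apply: eq_bigr => w _; rewrite !mxE natrM.
by rewrite Ps.
Qed.

Lemma no_excess_one (d : nat) (T : finType) (e : rel T) :
  (3 < d)%N -> (d * d + d + 2 <= 32)%N -> ~ excess_one_digraph e d 2.
Proof.
move=> d_gt3 d_le e_excess; have card_T := card_excess_one e_excess.
have d_gt0 : (0 < d)%N by lia.
(* The order is displayed as a successor, to match the index type ['I_n.+1] of the matrices. *)
have card_pred : (d * d + d).+1.+1 = #|T| by rewrite card_T; lia.
pose f i : T := enum_val (cast_ord card_pred i).
have f_bij : bijective f.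
  exists (fun x => cast_ord (esym card_pred) (enum_rank x)) => x.
    by rewrite /f enum_valK cast_ordK.
  by rewrite /f cast_ordKV enum_rankK.
apply: (no_excess_one_ord d_gt3 _ (excess_one_relpre f_bij e_excess)).
by move: d_le; rewrite addn2.
Qed.

Local Close Scope ring_scope.

Theorem theorem7 : ~ exists (T : finType) (e : rel T), excess_one_digraph e 5 2.
Proof. by case=> T [e]; apply: no_excess_one. Qed.
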